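(* Let $p$ be a prime and let $G$ be a finite $p$-group that is semiabelian. Then there are finite abelian $p$-groups $A_1,A_2,\ldots,A_r$ for which there is a rank preserving epimorphism $A_1\wr (A_2\wr \cdots \wr A_r)\to G$.
   Context: For a finite group $G$, $d(G)$ denotes the minimal number of generators of $G$ (with $d(\{1\})=0$). An epimorphism $G\to\Gamma$ of finite groups is rank preserving if $d(G)=d(\Gamma)$. The family $\mathcal{S}$ of semiabelian groups is the minimal family of (finite) groups satisfying: (1) $\{1\}\in\mathcal{S}$; (2) if $A$ is a finite abelian group and $H\in\mathcal{S}$ acts on $A$ (by automorphisms) then the semidirect product $A\rtimes H$ is in $\mathcal{S}$; (3) if $G\in\mathcal{S}$ and $G\to\Gamma$ is an epimorphism then $\Gamma\in\mathcal{S}$. A semiabelian $p$-group is a $p$-group that is a semiabelian group. For an abelian group $A$ and a finite group $H$, the (standard, i.e. regular) wreath product $A\wr H$ is the semidirect product $M_1^H(A)\rtimes H$, where $M_1^H(A)$ is the abelian group of all functions $f:H\to A$ (pointwise multiplication) with the $H$-action $f^h(x)=f(xh^{-1})$ for $x,h\in H$. The iterated wreath product is bracketed to the right: $A_1\wr(A_2\wr(\cdots\wr A_r))$; for $r=1$ it is $A_1$. *)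

(* Defs.v *)
From HB Require Import structures.
From mathcomp Require Import all_boot all_fingroup all_solvable.

Set Implicit Arguments.
Unset Strict Implicit.
Unset Printing Implicit Defensive.

Local Open Scope group_scope.

Inductive semiabelian :
    forall gT : finGroupType, {group gT} -> Prop :=
| semiabelian_triv (gT : finGroupType) : semiabelian [1 gT]%G
| semiabelian_sdprod (aT rT : finGroupType) (H : {group aT}) (A : {group rT})
    (to : groupAction H A) :
    abelian A -> semiabelian H -> semiabelian [set: sdprod_by to]%G
| semiabelian_epi (gT rT : finGroupType) (G : {group gT}) (K : {group rT})
    (f : {morphism G >-> rT}) :
    semiabelian G -> f @* G = K -> semiabelian K.

(* 'm(G) is the minimal number of generators d(G) *)
Definition rank_preserving_epi (gT rT : finGroupType) (G : {group gT})
    (K : {group rT}) (f : {morphism G >-> rT}) : Prop :=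
  f @* G = K /\ 'm(G) = 'm(K).

Section Wreath.

Variables aT hT : finGroupType.

(* The pointwise group of all functions hT -> aT; {dffun _}, unlike the
   convertible {ffun hT -> aT}, carries the canonical group structure. *)
Definition wreath_base : finGroupType := {dffun forall _ : hT, aT}.

Definition wreath_act (f : wreath_base) (h : hT) : wreath_base :=
  [ffun x => f (x * h^-1)].

Lemma wreath_act_is_action : is_action [set: hT] wreath_act.
Proof.
apply: is_total_action => [f | f h k].
  by apply/ffunP=> x; rewrite ffunE invg1 mulg1.
by apply/ffunP=> x; rewrite !ffunE invMg mulgA.
Qed.

Definition wreath_action := Action wreath_act_is_action.

Lemma wreath_act_is_groupAction :
  is_groupAction [set: wreath_base] wreath_action.
Proof.
move=> h _; rewrite inE; apply/andP; split.
  by apply/subsetP=> f _; rewrite inE.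
apply/morphicP=> f g _ _; rewrite !actpermE /=.
by apply/ffunP=> x; rewrite !ffunE.
Qed.

Definition wreath_groupAction := GroupAction wreath_act_is_groupAction.

Definition wreath : finGroupType := sdprod_by wreath_groupAction.

End Wreath.

(* iter_wreath A [:: B; ...; Z] is A wr (B wr (... wr Z)) *)
Fixpoint iter_wreath (A : finGroupType) (s : seq finGroupType) : finGroupType :=
  if s is B :: s' then wreath A (iter_wreath B s') else A.

(* Main.v *)
(** The property of being generated by a "layered" set (see [layered]) passes
    from H to A ><| H with A abelian and to epimorphic images, so every
    semiabelian group has it.  A subset of a layered set is again layered, and
    by Burnside's basis theorem a generating set of the p-group G contains one
    of size 'm(G).  So G is generated by a layered set with layers
    X_1, ..., X_r of total size 'm(G).  By the universal property of the
    regular wreath product, the inclusions of A_i = <<X_i>> extend to an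
    epimorphism from A_1 wr (... wr A_r) to G, and the source has rank at most
    the sum of the 'm(A_i), hence at most 'm(G). *)

Require Import Defs.
From HB Require Import structures.
From mathcomp Require Import all_boot all_fingroup all_solvable.

Set Implicit Arguments.
Unset Strict Implicit.
Unset Printing Implicit Defensive.

Local Open Scope group_scope.

(** * Small generating sets of p-groups *)

Section PgroupGenerators.

Variables (p : nat) (gT : finGroupType).
Implicit Types (G K : {group gT}) (X Y : {set gT}).

(** Take [Y] maximal for the size bound: an element of [X] outside [K <*> Y] would raise the index
    by a factor of at least [p], so it could be added. *)
Lemma pgroup_joing_subset G K X :
  p.-group G -> K \subset G -> X \subset G ->
  exists Y : {set gT},
    [/\ Y \subset X, X \subset K <*> Y & #|Y| <= logn p #|K <*> Y : K|].
Proof.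
move=> pG sKG sXG.
pose P Y := (Y \subset X) && (#|Y| <= logn p #|K <*> Y : K|).
have [|Y /maxsetP[/andP[sYX leY] maxY] _] := @maxset_exists _ P set0.
  by rewrite /P sub0set cards0.
exists Y; split=> //; apply/subsetP=> x Xx; apply/idPn=> notKYx.
have notYx: x \notin Y by apply: contra notKYx => /(subsetP (joing_subr K Y)).
suffices PxY: P (x |: Y) by rewrite -(maxY _ PxY (subsetUr _ _)) setU11 in notYx.
rewrite /P subUset sub1set Xx sYX cardsU1 notYx /=.
have sKYG: K <*> Y \subset G by rewrite join_subG sKG (subset_trans sYX).
have sKxYG: K <*> (x |: Y) \subset G.
  by rewrite join_subG sKG subUset sub1set (subsetP sXG) // (subset_trans sYX).
have sKYxY: K <*> Y \subset K <*> (x |: Y) by rewrite genS // setUS ?subsetUr.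
rewrite -(Lagrange_index sKYxY (joing_subl K Y)) lognM ?indexg_gt0 //.
rewrite -[1 + _]addnC addnC leq_add //.
have pKxY: p.-nat #|K <*> (x |: Y) : K <*> Y|.
  by apply: pnat_dvd (dvdn_indexg _ _) (pgroupS sKxYG pG).
rewrite lt0n; apply: contra notKYx => /eqP logn0.
have /eqP := part_pnat_id pKxY; rewrite p_part logn0 eq_sym indexg_eq1.
by move/subsetP; apply; rewrite mem_gen // !inE eqxx orbT.
Qed.

(** Apply [pgroup_joing_subset] to the Frattini subgroup: its index in [G] has base-[p] logarithm
    ['m(G)], and [Y] generates [G] as soon as it does so together with ['Phi(G)]. *)
Lemma pgroup_gen_subset G X :
  p.-group G -> <<X>> = G ->
  exists Y : {set gT}, [/\ Y \subset X, <<Y>> = G & #|Y| <= 'm(G)].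
Proof.
move=> pG genX; have sXG: X \subset G by rewrite -genX subset_gen.
have [Y [sYX sXY leY]] := pgroup_joing_subset pG (Phi_sub G) sXG.
have genPhiY: 'Phi(G) <*> Y = G.
  apply/eqP; rewrite eqEsubset join_subG Phi_sub (subset_trans sYX) //=.
  by rewrite -{1}genX gen_subG.
exists Y; split=> //; first exact: Phi_nongen.
have abE := Phi_quotient_abelem pG.
rewrite genPhiY -card_quotient ?gFnorm // -rank_abelem // in leY.
by rewrite (leq_trans leY) // -grank_abelian ?(abelem_abelian abE) // quotient_grank ?gFnorm.
Qed.

End PgroupGenerators.

(** * Layered sets *)

(** The condition says that the normal closure of [A] in [<<A :|: B>>] is abelian. Stated through
    commuting conjugates, it passes to subsets of [A] and [B], as normality of [<<A>>] would not. *)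
Inductive layered (gT : finGroupType) : {set gT} -> Prop :=
| layered0 : layered set0
| layeredU (A B : {set gT}) :
    layered B -> abelian (class_support A <<B>>) -> layered (A :|: B).

Lemma morphim_class_support (aT rT : finGroupType) (D : {group aT})
    (f : {morphism D >-> rT}) (A B : {set aT}) :
  A \subset D -> B \subset D ->
  f @* class_support A B = class_support (f @* A) (f @* B).
Proof.
move=> /subsetP sAD /subsetP sBD; apply/setP=> y; apply/idP/idP.
  case/morphimP=> x _ /imset2P[a b Aa Bb ->] ->.
  have [Da Db] := (sAD a Aa, sBD b Bb).
  by rewrite morphJ // memJ_class_support // mem_morphim.
case/imset2P=> _ _ /morphimP[a Da Aa ->] /morphimP[b Db Bb ->] ->.
by rewrite -morphJ ?mem_morphim ?memJ_class_support ?groupJ.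
Qed.

Lemma morphim_layered (aT rT : finGroupType) (D : {group aT})
    (f : {morphism D >-> rT}) (X : {set aT}) :
  X \subset D -> layered X -> layered (f @* X).
Proof.
move=> + layX; elim: layX => [|A B _ IHB abA]; first by rewrite morphim0; constructor.
rewrite subUset => /andP[sAD sBD]; rewrite morphimU; constructor; first exact: IHB.
by rewrite -morphim_gen // -morphim_class_support ?gen_subG // morphim_abelian.
Qed.

Lemma semiabelian_layered (gT : finGroupType) (G : {group gT}) :
  semiabelian G -> exists2 X : {set gT}, layered X & <<X>> = G.
Proof.
elim=> {gT G} [gT | aT rT H A to abA _ [X layX genX] | gT rT G K f _ [X layX genX] <-].
- by exists set0; [constructor | rewrite gen0].
- have sXH: X \subset H by rewrite -genX subset_gen.
  exists (sdpair1 to @* A :|: sdpair2 to @* X); last first.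
    rewrite -joingE -joing_idr -morphim_gen // genX /=.
    by rewrite norm_joinEr ?im_sdpair_norm ?im_sdpair.
  (* The embedded copy of [A] is normal, so conjugation by [H] does not leave this abelian group. *)
  constructor; first exact: morphim_layered.
  rewrite -morphim_gen // genX; apply: abelianS (morphim_abelian (sdpair1 to) abA).
  exact: class_support_sub_norm (im_sdpair_norm to).
have sXG: X \subset G by rewrite -genX subset_gen.
by exists (f @* X); [apply: morphim_layered | rewrite -morphim_gen ?genX].
Qed.

(** * Rank and universal property of wreath products *)

Section WreathProducts.

Variables aT hT : finGroupType.

Let base : finGroupType := wreath_base aT hT.
Let to := wreath_groupAction aT hT.

Let at1 (a : aT) : base := dfung1 (i := 1 : hT) a.

Lemma wreath_act_dfung1 (a : aT) (h : hT) :
  wreath_act (at1 a) h = (dfung1 (i := h) a : base).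
Proof.
apply/ffunP=> x; rewrite !ffunE.
have [->|neq_hx] := eqVneq h x; first by rewrite mulgV !dfwith_in.
by rewrite !dfwith_out // eq_sym -eq_mulgV1 eq_sym.
Qed.

(** Base generators are needed at coordinate 1 only, since conjugation by the top group carries it
    to every other coordinate. *)
Lemma wreath_gen (A : {set aT}) (B : {set hT}) :
  <<A>> = setT -> <<B>> = setT ->
  <<(sdpair1 to @* (dfung1 (i := 1 : hT) @* A)) :|: (sdpair2 to @* B)>>
    = [set: wreath aT hT].
Proof.
move=> genA genB; apply/eqP; rewrite -subTset -(im_sdpair to) -joingE.
rewrite -joing_idl -joing_idr -!morphim_gen ?subsetT // genA genB.
set S := _ <*> _; have sTS: sdpair2 to @* setT \subset S by apply: joing_subr.
rewrite mul_subG //; apply/subsetP=> _ /morphimP[f _ _ ->].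
have -> : f = \prod_(h : hT) (dfung1 (i := h) (f h) : base).
  apply/ffunP=> h; rewrite prodg_ffun (big_only1 h) ?dfung1_id // => k neq_kh _.
  by rewrite dfung1_dflt.
rewrite morph_prod => [|h _]; last by rewrite inE.
apply: group_prod => h _; rewrite /= -wreath_act_dfung1.
rewrite (@sdpair_act _ _ _ _ to) ?inE // groupJ //.
  by rewrite (subsetP (joing_subl _ _)) // !mem_morphim ?inE.
by rewrite (subsetP sTS) // mem_morphim ?inE.
Qed.

Lemma grank_wreath :
  'm([set: wreath aT hT]) <= 'm([set: aT]) + 'm([set: hT]).
Proof.
have [A genA <-] := grank_witness [set: aT].
have [B genB <-] := grank_witness [set: hT].
rewrite -(wreath_gen genA genB) (leq_trans (grank_min _)) //.
rewrite (leq_trans (leq_card_setU _ _)) // leq_add ?leq_morphim //.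
by rewrite (leq_trans (leq_morphim _ _)) ?leq_morphim.
Qed.

Variables (gT : finGroupType) (alpha : {morphism [set: aT] >-> gT}).
Variable psi : {morphism [set: hT] >-> gT}.
Hypothesis abel : abelian (class_support (alpha @* setT) (psi @* setT)).

(** Any extension of [alpha], placed at coordinate 1, that is compatible with [psi] must have this
    form; [abel] makes the factors commute. *)
Definition wreath_base_map (f : base) : gT := \prod_(h : hT) alpha (f h) ^ psi h.

Let M := <<class_support (alpha @* setT) (psi @* setT)>>%G.

Let abelM : abelian M. Proof. by rewrite abelian_gen. Qed.

Let memM a h : alpha a ^ psi h \in M.
Proof. by rewrite mem_gen // memJ_class_support ?mem_morphim ?inE. Qed.

Lemma wreath_base_map_morphM : {in [set: base] &, {morph wreath_base_map : f g / f * g}}.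
Proof.
move=> f g _ _; rewrite /wreath_base_map -prodgM_commute => [|h k _ _].
  by apply: eq_bigr => h _; rewrite mulg_ffun morphM ?inE // conjMg.
exact: (centsP abelM).
Qed.

Canonical wreath_base_morphism := Morphism wreath_base_map_morphM.

Lemma wreath_base_map_act :
  {in [set: base] & [set: hT], morph_act to 'J wreath_base_map psi}.
Proof.
move=> f k _ _; rewrite /= /wreath_base_map.
(* Acting by [k] permutes the factors; this central product of copies of the abelian [M] licenses
   the reindexing. *)
have bigM: \big[cprod/1]_(h : hT) M = (\prod_(h : hT) M)%G by apply: (bigcprodEY _ abelM).
rewrite (reindex_bigcprod (h := fun h => h * k) _ bigM) => [||h _]; last exact: memM.
  rewrite (big_morph (conjg^~ (psi k)) (fun x y => conjMg x y _) (conj1g _)).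
  by apply: eq_bigr => h _; rewrite ffunE mulgK morphM ?inE // conjgM.
by apply: onW_bij; exists (fun h => h * k^-1) => h; rewrite ?mulgK ?mulgKV.
Qed.

Lemma wreath_base_map_at1 a : wreath_base_map (dfung1 (i := 1) a) = alpha a.
Proof.
rewrite /wreath_base_map (big_only1 1) //; first by rewrite dfung1_id morph1 conjg1.
by move=> h neq_h1 _; rewrite dfung1_dflt 1?eq_sym // morph1 conj1g.
Qed.

Lemma wreath_lift :
  exists f : {morphism [set: wreath aT hT] >-> gT},
    f @* setT = (alpha @* setT) <*> (psi @* setT).
Proof.
have im_lift := im_xsdprodm wreath_base_map_act.
exists (xsdprod_morphism wreath_base_map_act); apply: (etrans im_lift).
apply/eqP; rewrite eqEsubset; apply/andP; split.
  rewrite mul_subG ?joing_subr //; apply/subsetP=> _ /morphimP[f _ _ ->].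
  apply: group_prod => h _; rewrite groupJ //.
    by rewrite (subsetP (joing_subl _ _)) // mem_morphim ?inE.
  by rewrite (subsetP (joing_subr _ _)) // mem_morphim ?inE.
(* The product set is the image of a morphism, hence a group, so it suffices to place generators in
   it. *)
have gen_sub_im (Z : {set gT}) : Z \subset wreath_base_map @* setT * psi @* setT ->
    <<Z>> \subset wreath_base_map @* setT * psi @* setT.
  by rewrite -im_lift gen_subG.
apply: gen_sub_im; rewrite subUset mulG_subr andbT.
apply: subset_trans (mulG_subl _ _); apply/subsetP=> _ /morphimP[a _ _ ->].
by rewrite -wreath_base_map_at1 mem_morphim ?inE.
Qed.

End WreathProducts.

(* The statement for subsets Y of X lets the layers be made disjoint
   (Y = (Y :\: B) :|: (Y :&: B)), so that their sizes add up to #|Y|. *)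
Lemma layered_iter_wreath (p : nat) (gT : finGroupType) (X Y : {set gT}) :
  layered X -> Y \subset X -> p.-group <<X>> ->
  exists (A1 : finGroupType) (As : seq finGroupType),
    [/\ all (fun A : finGroupType => abelian [set: A] && p.-group [set: A])
          (A1 :: As),
        'm([set: iter_wreath A1 As]) <= #|Y|
      & exists f : {morphism [set: iter_wreath A1 As] >-> gT},
          f @* setT = <<Y>>].
Proof.
pose good (A : finGroupType) := abelian [set: A] && p.-group [set: A].
have good_subg (C : {group gT}) : abelian C -> p.-group C -> good (subg_of C).
  move=> abC pC; rewrite /good -(isog_abelian (isog_subg C)) abC.
  by rewrite -(isog_pgroup p (isog_subg C)).
have grank_subg (C : {set gT}) : 'm([set: subg_of <<C>>%G]) <= #|C|.
  by rewrite -(isog_grank (isog_subg <<C>>%G)) grank_min.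
move=> layX; elim: layX Y => [|A B _ IHB abAB] Y sYX pX.
  (* An iterated wreath product has at least one factor, so no layers give the trivial group. *)
  have gen1: <<Y>> = 1 by apply/trivgP; rewrite gen_subG (subset_trans sYX) ?sub0set.
  exists (subg_of <<Y>>%G), [::]; split; first last.
  - by exists (sgval_morphism <<Y>>%G); apply: im_sgval.
  - exact: grank_subg.
  by rewrite /= andbT; apply: good_subg; rewrite /= gen1 ?abelian1 ?pgroup1.
have pB: p.-group <<B>> by apply: pgroupS pX; rewrite genS ?subsetUr.
have [A1 [As [allA1 leA1 [psi im_psi]]]] := IHB (Y :&: B) (subsetIr _ _) pB.
have sYBA: Y :\: B \subset A by rewrite subDset setUC.
have abM: abelian <<class_support A <<B>>>> by rewrite abelian_gen.
have sYBM: <<Y :\: B>> \subset <<class_support A <<B>>>>.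
  by rewrite genS // (subset_trans sYBA) // sub_class_support.
exists (subg_of <<Y :\: B>>%G), (A1 :: As); split.
- apply/andP; split; last exact: allA1.
  apply: good_subg; first exact: abelianS sYBM abM.
  by apply: pgroupS pX; rewrite genS // (subset_trans sYBA) ?subsetUl.
- apply: leq_trans (grank_wreath _ _) _.
  by rewrite -(cardsID B Y) [leqRHS]addnC; exact: leq_add (grank_subg _) leA1.
(* Conjugates of [Y :\: B] under [<<Y :&: B>>] stay in the abelian group
   [<<class_support A <<B>>>>], which [<<B>>] normalises. *)
have [|f im_f] := @wreath_lift _ _ _ (sgval_morphism <<Y :\: B>>%G) psi.
  rewrite im_sgval im_psi; apply: abelianS abM.
  apply: class_support_sub_norm sYBM _.
  rewrite (subset_trans (genS (subsetIr Y B))) // norms_gen //.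
  exact: class_support_norm.
exists f; rewrite im_f im_psi im_sgval /=.
by rewrite joing_idl joing_idr joingE setUC setID.
Qed.

Theorem theorem1p3 (p : nat) (gT : finGroupType) (G : {group gT}) :
  prime p -> p.-group G -> semiabelian G ->
  exists (A1 : finGroupType) (As : seq finGroupType),
    all (fun A : finGroupType => abelian [set: A] && p.-group [set: A])
        (A1 :: As) /\
    exists f : {morphism [set: iter_wreath A1 As]%G >-> gT},
      rank_preserving_epi G f.
Proof.
move=> _ pG /semiabelian_layered[X layX genX].
have [Y [sYX genY leY]] := pgroup_gen_subset pG genX.
have pX: p.-group <<X>> by rewrite genX.
have [A1 [As [allA leW [f im_f]]]] := layered_iter_wreath layX sYX pX.
exists A1, As; split=> //; exists f; rewrite /rank_preserving_epi im_f genY.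
split=> //; apply/eqP; rewrite eqn_leq (leq_trans leW leY) /=.
(* The reverse inequality: an image needs no more generators than its source. *)
by rewrite -genY -im_f morphim_grank.
Qed.
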